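(* Let $n\ge 1$. The functor $\mathrm{CRing}\to\mathrm{Set}$, $\mathcal{R}\mapsto\mathcal{R}\mathds{1}^{n-1}$, from commutative rings to sets is representable by the ring $$\mathbb{Z}[\{x^i_j\}_{i,j=1}^n]/I,$$ where $I$ is the ideal generated by $$\sum_{i=1}^n x^j_ix^i_k-x^j_k,\qquad \sum_{i=1}^n x^i_i-1,\qquad x^j_kx^l_m-x^j_mx^l_k,\qquad\text{for all }1\le j,k,l,m\le n.$$
   Context: For a commutative ring $\mathcal{R}$, $\mathcal{R}\mathds{1}^{n-1}$ denotes the set of rank-1 projections in $M_n(\mathcal{R})$: the idempotents $q\in M_n(\mathcal{R})$ such that the map $Z(M_n(\mathcal{R}))\to qM_n(\mathcal{R})q$, $r\mapsto rq$, is a bijection, where $Z$ denotes the center. Equivalently, they are the idempotents $q\in M_n(\mathcal{R})$ whose image $\mathrm{im}(q)\subset\mathcal{R}^n$ is a projective module of rank $1$. A ring homomorphism acts on matrices entrywise. In $x^i_j$ the upper index is the row and the lower index the column. *)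

(* Defs.v *)
From HB Require Import structures.
From mathcomp Require Import all_boot all_order all_algebra.
From mathcomp Require Import mpoly.
From mathcomp Require Import boolp classical_sets functions.
Set Implicit Arguments.
Unset Strict Implicit.
Unset Printing Implicit Defensive.
Import GRing.Theory.
Local Open Scope classical_set_scope.
Local Open Scope ring_scope.

(* Commutative rings are [comPzRingType]s: the zero ring is allowed. *)
Record cring_functor := CRingFunctor {
  fobj :> comPzRingType -> Type;
  fmap : forall R S : comPzRingType, {rmorphism R -> S} -> fobj R -> fobj S;
  fmap_id : forall (R : comPzRingType) (x : fobj R), fmap idfun x = x;
  fmap_comp : forall (R S T : comPzRingType)
      (g : {rmorphism S -> T}) (f : {rmorphism R -> S}) (x : fobj R),
    fmap (g \o f) x = fmap g (fmap f x)
}.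
Arguments fmap F {R S} f x : rename.

(* [eta] is a natural isomorphism from Hom(A, -) to F. *)
Definition represented_by (F : cring_functor) (A : comPzRingType) :=
  exists eta : forall R : comPzRingType, {rmorphism A -> R} -> F R,
    (forall R, bijective (@eta R)) /\
    (forall (R S : comPzRingType) (f : {rmorphism R -> S})
        (g : {rmorphism A -> R}), eta S (f \o g) = fmap F f (eta R g)).

Definition ring_center (M : pzRingType) : set M :=
  [set z | forall x, z * x = x * z].
Arguments ring_center : clear implicits.

Definition corner (M : pzRingType) (q : M) : set M :=
  [set q * x * q | x in [set: M]].

Definition rank1_projection (R : comPzRingType) (n : nat) (q : 'M[R]_n) : Prop :=
  q * q = q /\ set_bij (ring_center 'M[R]_n) (corner q) (fun r => r * q).


Lemma ring_center_scalar (R : comPzRingType) (n : nat) (z : 'M[R]_n) :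
  ring_center 'M[R]_n z <-> exists a, z = a%:M.
Proof.
split=> [|[a ->] x]; last by rewrite -!mulmxE scalar_mxC.
case: n z => [|n] z zC; first by exists 0; apply/matrixP => -[].
have zE i j k : z k i = z j j *+ (k == i).
  have /matrixP/(_ k j) := zC (delta_mx i j); rewrite -!mulmxE !mxE.
  rewrite (bigD1 i)//= mxE !eqxx mulr1 big1 ?addr0 => [|l /negPf li]; last first.
    by rewrite mxE li mulr0.
  rewrite (bigD1 j)//= mxE eqxx andbT big1 ?addr0 => [->|l /negPf lj].
    by rewrite mulr_natl.
  by rewrite mxE lj andbF mul0r.
by exists (z ord0 ord0); apply/matrixP => i j; rewrite mxE (zE j ord0).
Qed.

Lemma mulmx_delta_mulmx (R : comPzRingType) (n : nat) (q : 'M[R]_n) k l i j :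
  (q *m delta_mx k l *m q) i j = q i k * q l j.
Proof.
rewrite mxE (bigD1 l)//= mxE (bigD1 k)//= mxE !eqxx mulr1.
rewrite big1 ?addr0 => [|m /negPf mk]; last by rewrite mxE mk mulr0.
rewrite big1 ?addr0 // => m /negPf ml; rewrite mxE big1 ?mul0r // => p _.
by rewrite mxE ml andbF mulr0.
Qed.

Lemma rank1_projectionP (R : comPzRingType) (n : nat) (q : 'M[R]_n) :
  rank1_projection q <->
  [/\ q *m q = q, forall a, a *: q = 0 -> a%:M = 0 :> 'M_n &
      exists a : 'M[R]_n, forall k l, q *m delta_mx k l *m q = a k l *: q].
Proof.
split=> [[qq [_ inj surj]]|[qq faith [a aE]]].
  split=> // [b bq|].
    apply: inj; rewrite ?inE; last by rewrite mul0r -mulmxE mul_scalar_mx.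
      by apply/ring_center_scalar; exists b.
    by move=> x; rewrite mul0r mulr0.
  have H k l : exists b, q *m delta_mx k l *m q = b *: q.
    have [|z /ring_center_scalar[b ->] zE] := surj (q * delta_mx k l * q).
      by exists (delta_mx k l).
    by exists b; rewrite !mulmxE -zE -mulmxE mul_scalar_mx.
  exists (\matrix_(k, l) projT1 (cid (H k l))) => k l.
  by rewrite mxE; case: cid.
split=> //; split.
- move=> _ /ring_center_scalar[b ->]; exists b%:M => //.
  by rewrite -!mulmxE scalar_mxC -mulmxA qq.
- move=> y z; rewrite !inE => /ring_center_scalar[b ->] /ring_center_scalar[c ->].
  rewrite -!mulmxE !mul_scalar_mx => /eqP; rewrite -subr_eq0 -scalerBl => /eqP.
  by move=> /faith; rewrite raddfB => /subr0_eq.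
move=> _ [x _ <-]; exists (\sum_k \sum_l x k l * a k l)%:M.
  by apply/ring_center_scalar; eexists.
rewrite -!mulmxE mul_scalar_mx [in RHS](matrix_sum_delta x).
rewrite mulmx_sumr mulmx_suml scaler_suml; apply: eq_bigr => k _.
rewrite mulmx_sumr mulmx_suml scaler_suml; apply: eq_bigr => l _.
by rewrite -scalemxAr -scalemxAl aE scalerA.
Qed.

Lemma rank1_projection_map (R S : comPzRingType) (n : nat)
    (f : {rmorphism R -> S}) (q : 'M[R]_n) :
  rank1_projection q -> rank1_projection (map_mx f q).
Proof.
move=> /rank1_projectionP[qq faith [a aE]]; apply/rank1_projectionP.
have aq1 : (\sum_k \sum_l q k l * a k l)%:M = 1%:M :> 'M_n.
  apply/subr0_eq; rewrite -raddfB; apply: faith.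
  have qqq : q = q *m q *m q by rewrite !qq.
  rewrite scalerBl scale1r [X in _ - X]qqq.
  rewrite [X in _ *m X *m _](matrix_sum_delta q).
  rewrite mulmx_sumr mulmx_suml scaler_suml -sumrB big1 // => k _.
  rewrite mulmx_sumr mulmx_suml scaler_suml -sumrB big1 // => l _.
  by rewrite -scalemxAr -scalemxAl aE scalerA subrr.
split=> [|b bq|]; first by rewrite -map_mxM qq.
  have bq0 k l : b * f (q k l) = 0 by have /matrixP/(_ k l) := bq; rewrite !mxE.
  have /(congr1 (map_mx f)) := aq1; rewrite !map_scalar_mx rmorph1 => fa.
  rewrite -[LHS]mulmx1 -fa -scalar_mxM !rmorph_sum mulr_sumr big1 ?raddf0 //.
  move=> k _; rewrite rmorph_sum mulr_sumr big1 // => l _.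
  by rewrite rmorphM mulrA bq0 mul0r.
exists (map_mx f a) => k l; rewrite -(map_delta_mx f) -!map_mxM aE map_mxZ.
by rewrite mxE.
Qed.

Definition rank1_map (n : nat) (R S : comPzRingType) (f : {rmorphism R -> S})
    (q : {q : 'M[R]_n | rank1_projection q}) :
    {q : 'M[S]_n | rank1_projection q} :=
  exist _ (map_mx f (sval q)) (rank1_projection_map f (svalP q)).

Lemma rank1_map_id (n : nat) (R : comPzRingType)
    (q : {q : 'M[R]_n | rank1_projection q}) : rank1_map idfun q = q.
Proof. by apply: eq_sig_hprop => [?|]; [exact: Prop_irrelevance|rewrite /= map_mx_id]. Qed.

Lemma rank1_map_comp (n : nat) (R S T : comPzRingType)
    (g : {rmorphism S -> T}) (f : {rmorphism R -> S})
    (q : {q : 'M[R]_n | rank1_projection q}) :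
  rank1_map (g \o f) q = rank1_map g (rank1_map f q).
Proof. by apply: eq_sig_hprop => [?|]; [exact: Prop_irrelevance|rewrite /= map_mx_comp]. Qed.

Definition rank1_functor (n : nat) : cring_functor :=
  @CRingFunctor (fun R => {q : 'M[R]_n | rank1_projection q})
    (@rank1_map n) (@rank1_map_id n) (@rank1_map_comp n).

Definition ideal_span (R : comNzRingType) (G : set R) : set R :=
  [set p | exists2 s : seq (R * R),
     (forall c, c \in s -> G c.2) & p = \sum_(c <- s) c.1 * c.2].

(* The variable x^i_j is the (i, j) entry of [generic_mx n]. *)
Definition generic_mx (n : nat) : 'M[{mpoly int[n * n]}]_n :=
  \matrix_(i, j) 'X_(mxvec_index i j).

Definition rank1_relations (n : nat) : set {mpoly int[n * n]} :=
  let x := generic_mx n in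
  [set p |
    [\/ exists j k, p = \sum_i x j i * x i k - x j k,
        p = \sum_i x i i - 1 |
        exists j k l m, p = x j k * x l m - x j m * x l k]].
Arguments rank1_relations : clear implicits.

(* The type records n > 0, which makes the ideal proper; [{ideal_quot _}] is
   only defined for proper ideals. *)
Definition rank1_ideal (n : nat) (n_gt0 : (0 < n)%N) : pred {mpoly int[n * n]} :=
  fun p => `[< ideal_span (rank1_relations n) p >].

Lemma rank1_ideal_closed (n : nat) (n_gt0 : (0 < n)%N) :
  idealr_closed (rank1_ideal n_gt0).
Proof.
split.
- by apply/asboolP; exists [::]; rewrite ?big_nil.
- apply/negP => /asboolP[s sG].
  pose i0 := Ordinal n_gt0.
  pose e : {rmorphism {mpoly int[n * n]} -> int} :=
    meval (mxvec (delta_mx i0 i0) ord0).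
  have eX i j : e (generic_mx n i j) = ((i == i0) && (j == i0))%:R.
    by rewrite mxE /= mevalXU mxvecE mxE.
  move=> /(congr1 e); rewrite rmorph1 rmorph_sum big_seq big1 // => c cs.
  rewrite rmorphM; have -> : e c.2 = 0; last by rewrite mulr0.
  case: (sG _ cs) => [[j [k ->]]|->|[j [k [l [m ->]]]]].
  - rewrite rmorphB rmorph_sum (bigD1 i0)// big1 => [|i /negPf ii0].
      by rewrite rmorphM !eX eqxx andbT /= addr0 -natrM mulnb subrr.
    by rewrite rmorphM !eX ii0 andbF mul0r.
  - rewrite rmorphB rmorph1 rmorph_sum (bigD1 i0)// big1 => [|i /negPf ii0].
      by rewrite eX eqxx /= addr0 subrr.
    by rewrite eX ii0.
  by rewrite rmorphB !rmorphM !eX -!natrM !mulnb andbACA (andbC (k == i0)) andbACA subrr.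
move=> a p q /asboolP[s sG ->] /asboolP[t tG ->]; apply/asboolP.
exists ([seq (a * c.1, c.2) | c <- s] ++ t).
  by move=> c; rewrite mem_cat => /orP[/mapP[d /sG dG ->]|/tG].
rewrite big_cat big_map mulr_sumr /=; congr (_ + _).
by apply: eq_bigr => c _; rewrite mulrA.
Qed.

HB.instance Definition _ (n : nat) (n_gt0 : (0 < n)%N) :=
  isIdealr.Build {mpoly int[n * n]} (rank1_ideal n_gt0)
    (rank1_ideal_closed n_gt0).

Definition rank1_ring (n : nat) (n_gt0 : (0 < n)%N) : comNzRingType :=
  {ideal_quot (rank1_ideal n_gt0 : idealr {mpoly int[n * n]})}.

(* Main.v *)
Require Import Defs.
From HB Require Import structures.
From mathcomp Require Import all_boot all_order all_algebra.
From mathcomp Require Import ring mpoly.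
From mathcomp Require Import boolp classical_sets functions.
Set Implicit Arguments.
Unset Strict Implicit.
Unset Printing Implicit Defensive.
Import GRing.Theory.
Local Open Scope ring_scope.

(** The heart of the matter is that an idempotent matrix [q] over a commutative
    ring is a rank-1 projection exactly when its trace is 1 and its 2x2 minors
    vanish.  Once this is known, a ring map out of the quotient is a matrix
    satisfying the defining relations, that is, a rank-1 projection; by Yoneda
    the isomorphism is [f |-> f(u)], where [u] is the image of the generic
    matrix in the quotient ring, and naturality is functoriality.

    If the trace is 1 and the minors vanish, then [q E_kl q = q_lk q] for the
    elementary matrices [E_kl], so the corner of [q] consists of scalar
    multiples of [q], and [q] is faithful because [a q = 0] gives
    [a = a tr(q) = 0] ([rank1_equations_projection]).

    The converse ([rank1_projection_equations]) is usually proved by localizing,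
    since a module of rank 1 is locally free; the argument below is a direct
    computation.  The corner condition yields a matrix [a] with
    [q_ik q_lj = a_kl q_ij] for all indices, and every claim is tested by
    multiplying it with the entries of [q], which have no common annihilator.
    Summing over [k = l] and using [q^2 = q] gives [tr a = 1].  With
    [t = tr q], the two ways of reading [q_ik q_lj] as a product give
    [a_kl q_ij = a_ji q_lk], and summing over [i = j] gives [q_lk = t a_kl].
    Equating all four indices gives [t (t - 1) a_ii^2 = 0].  As the [a_ii] sum
    to 1, their squares generate the unit ideal, so [t (t - 1) = 0]
    ([eq0_sum1_sqr]); hence [(t - 1) q = 0] and [t = 1].  Then [q_lk = a_kl],
    and the corner identity is the vanishing of the minors. *)

(** If elements generate the unit ideal then so do their squares.  Instead of
    expanding a large power of the sum, the induction removes one summand [u] at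
    a time: [b u] is killed by [u], so it is an instance of the statement for
    the remaining summands, hence [b u = 0], and then so is [b] itself.  The
    sum being 1 is weakened to [b (1 - sum) = 0], which both steps preserve. *)
Lemma eq0_sum1_sqr (R : comPzRingType) (s : seq R) (b : R) :
  \sum_(u <- s) u = 1 -> (forall u, u \in s -> b * u ^+ 2 = 0) -> b = 0.
Proof.
move=> s1 bs.
have : b * (1 - \sum_(u <- s) u) = 0 by rewrite s1 subrr mulr0.
elim: s b bs {s1} => [|u s IHs] b bs.
  by rewrite big_nil subr0 mulr1.
rewrite big_cons opprD addrA => bS.
have bs_tl v : v \in s -> b * v ^+ 2 = 0.
  by move=> vs; apply: bs; rewrite inE vs orbT.
have bu2 : b * u ^+ 2 = 0 by apply: bs; rewrite inE eqxx.
set S := \sum_(_ <- s) _ in IHs bS *.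
have bu : b * u = 0.
  apply: IHs => [v /bs_tl bv|]; first by rewrite mulrAC bv mul0r.
  have -> : b * u * (1 - S) = u * (b * (1 - u - S)) + b * u ^+ 2 by ring.
  by rewrite bS bu2 mulr0 addr0.
apply: IHs => //; have -> : b * (1 - S) = b * (1 - u - S) + b * u by ring.
by rewrite bS bu addr0.
Qed.

Definition rank1_equations (R : comPzRingType) (n : nat) (q : 'M[R]_n) : Prop :=
  [/\ q *m q = q, \tr q = 1 &
      forall j k l m, q j k * q l m = q j m * q l k].

Lemma rank1_equations_projection (R : comPzRingType) (n : nat) (q : 'M[R]_n) :
  rank1_equations q -> rank1_projection q.
Proof.
case=> qq trq minors; apply/rank1_projectionP; split=> // [a aq|].
  have -> : a = 0; last by rewrite raddf0.
  by rewrite -[a]mulr1 -trq -linearZ /= aq raddf0.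
exists q^T => k l; apply/matrixP => i j.
by rewrite mulmx_delta_mulmx !mxE minors mulrC.
Qed.

(** Nonzero [n] is what lets faithfulness act on scalars: it gives [b%:M = 0],
    and [b] is an entry of [b%:M]. *)
Lemma rank1_projection_equations (R : comPzRingType) (n : nat) (q : 'M[R]_n) :
  (0 < n)%N -> rank1_projection q -> rank1_equations q.
Proof.
move=> n_gt0 /rank1_projectionP[qq faith [a aE]].
have ann b : (forall i j, b * q i j = 0) -> b = 0.
  move=> bq; have : b *: q = 0 by apply/matrixP => i j; rewrite !mxE.
  move/faith/matrixP/(_ (Ordinal n_gt0) (Ordinal n_gt0)).
  by rewrite !mxE eqxx.
have qaE i k l j : q i k * q l j = a k l * q i j.
  by have /matrixP/(_ i j) := aE k l; rewrite mulmx_delta_mulmx !mxE.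
(* the sum over k of [q i k * q k j] is the entry of [q *m q = q] *)
have tra : \tr a = 1.
  apply/subr0_eq/ann => i j; rewrite mulrBl mul1r /mxtrace mulr_suml.
  rewrite -[in X in _ - X]qq mxE -sumrB big1 // => k _.
  by rewrite -qaE subrr.
pose t := \tr q.
(* commuting [q i k * q l i] gives [a k l * q i i = a i i * q l k] *)
have qE l k : q l k = t * a k l.
  rewrite -[LHS]mul1r -tra /t /mxtrace !mulr_suml; apply: eq_bigr => i _.
  by rewrite -qaE mulrC qaE mulrC.
(* all indices equal: [q i i ^+ 2 = a i i * q i i], where [q i i = t * a i i] *)
have tt0 : t * (t - 1) = 0.
  apply: (@eq0_sum1_sqr _ [seq a i i | i <- enum 'I_n]).
    by rewrite big_map big_enum.
  move=> _ /mapP[i _ ->].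
  have := qaE i i i i; rewrite qE => /eqP; rewrite -subr_eq0 => /eqP <-.
  by ring.
have t1 : t = 1.
  apply/subr0_eq/ann => i j; rewrite qE.
  by rewrite mulrA [_ * t]mulrC tt0 mul0r.
split=> // j k l m; rewrite qaE mulrC; congr (_ * _).
by rewrite qE t1 mul1r.
Qed.

(** Evaluation of polynomials needs a nontrivial target ring, whereas [R] may be
    the zero ring; there the constant map is the required morphism. *)
Lemma mpoly_int_lift (R : comPzRingType) (k : nat) (h : 'I_k -> R) :
  exists f : {rmorphism {mpoly int[k]} -> R}, forall i, f 'X_i = h i.
Proof.
have [R0|/eqP R_neq0] := pselect (1 = 0 :> R).
  have all0 (x : R) : x = 0 by rewrite -[x]mul1r R0 mul0r.
  pose z (_ : {mpoly int[k]}) : R := 0.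
  have zB : zmod_morphism z by move=> x y; rewrite /z subrr.
  have zM : monoid_morphism z by split=> [|x y]; rewrite /z ?R0 ?mulr0.
  pose A := GRing.isZmodMorphism.Build _ _ z zB.
  pose M := GRing.isMonoidMorphism.Build _ _ z zM.
  pose f : {rmorphism _ -> _} := HB.pack z A M.
  by exists f => i; rewrite [h i]all0 [LHS]all0.
pose N := GRing.PzSemiRing_isNonZero.Build R R_neq0.
pose R' : comNzRingType := HB.pack R N.
pose f : {rmorphism {mpoly int[k]} -> R'} := mmap intr (h : 'I_k -> R').
by exists f => i; rewrite /f /= mmapX mmap1U.
Qed.

Lemma mpoly_int_hom_eq (R : comPzRingType) (k : nat)
    (f g : {rmorphism {mpoly int[k]} -> R}) :
  (forall i, f 'X_i = g 'X_i) -> f =1 g.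
Proof.
move=> fg; elim/mpolyind => [|c m p _ _ IHp]; first by rewrite !rmorph0.
rewrite !rmorphD IHp -mul_mpolyC !rmorphM -[c]intz !rmorph_int mpolyXE_id.
rewrite !rmorph_prod; congr (_ * _ + _); apply: eq_bigr => i _.
by rewrite !rmorphXn fg.
Qed.

Lemma ideal_quot_lift (P : comNzRingType) (I : idealr P) (R : comPzRingType)
    (f : {rmorphism P -> R}) :
  (forall p, p \in I -> f p = 0) ->
  exists g : {rmorphism {ideal_quot I} -> R},
    forall p, g (\pi_{ideal_quot I} p)%qT = f p.
Proof.
move=> fI; pose g (x : {ideal_quot I}) := f (repr x).
have gpi p : g (\pi_{ideal_quot I} p)%qT = f p.
  apply/subr0_eq; rewrite -rmorphB fI // Quotient.idealrBE.
  by rewrite reprK.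
have gB : zmod_morphism g.
  move=> x y; rewrite -[x]reprK -[y]reprK -rmorphB !gpi.
  by rewrite rmorphB.
have gM : monoid_morphism g.
  split=> [|x y]; first by rewrite -(rmorph1 (\pi_{ideal_quot I})%qT) gpi rmorph1.
  rewrite -[x]reprK -[y]reprK -rmorphM !gpi.
  by rewrite rmorphM.
pose A := GRing.isZmodMorphism.Build _ _ g gB.
pose M := GRing.isMonoidMorphism.Build _ _ g gM.
pose h : {rmorphism _ -> _} := HB.pack g A M.
by exists h.
Qed.

(** Injectivity of the representing bijection concerns bundled morphisms, so
    equality of the underlying maps must be lifted to the bundles. *)
Lemma rmorph_ext (R S : pzRingType) (f g : {rmorphism R -> S}) :
  f =1 g -> f = g.
Proof.
case: f g => [f [[fA] [fM]]] [g [[gA] [gM]]] /= /funext fg.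
case: g / fg gA gM => gA gM.
by rewrite (Prop_irrelevance fA gA) (Prop_irrelevance fM gM).
Qed.

(** Bridge between matrices and morphisms.  It is used twice: for the quotient
    map, to see that the universal matrix is a rank-1 projection, and for the
    evaluation at a given rank-1 projection, to see that it factors. *)
Lemma rank1_equations_generic (R : comPzRingType) (n : nat)
    (f : {rmorphism {mpoly int[n * n]} -> R}) :
  rank1_equations (map_mx f (generic_mx n)) <->
  forall p, rank1_relations n p -> f p = 0.
Proof.
set x := generic_mx n; set q := map_mx f x.
have fx i j : f (x i j) = q i j by rewrite [RHS]mxE.
have fqq j k : f (\sum_i x j i * x i k - x j k) = (q *m q) j k - q j k.
  rewrite rmorphB fx rmorph_sum [(q *m q) j k]mxE; congr (_ - _).
  by apply: eq_bigr => i _; rewrite rmorphM !fx.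
have ftr : f (\sum_i x i i - 1) = \tr q - 1.
  by rewrite rmorphB rmorph1 rmorph_sum (eq_bigr (fun i => q i i)).
have fminor j k l m :
    f (x j k * x l m - x j m * x l k) = q j k * q l m - q j m * q l k.
  by rewrite rmorphB !rmorphM !fx.
split=> [[qq trq minors] _ [[j [k ->]]|->|[j [k [l [m ->]]]]] | f0].
- by rewrite fqq qq subrr.
- by rewrite ftr trq subrr.
- by rewrite fminor minors subrr.
split=> [||j k l m]; last 1 first.
- by apply: subr0_eq; rewrite -fminor f0 //; apply: Or33; exists j, k, l, m.
- apply/matrixP => j k; apply: subr0_eq.
  by rewrite -fqq f0 //; apply: Or31; exists j, k.
by apply: subr0_eq; rewrite -ftr f0 //; apply: Or32.
Qed.

(** The quotient map, bundled as a morphism so that the lemmas about morphisms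
    apply to it and to its composites. *)
Definition rank1_pi (n : nat) (n_gt0 : (0 < n)%N) :
    {rmorphism {mpoly int[n * n]} -> rank1_ring n_gt0} :=
  (\pi_(rank1_ring n_gt0))%qT.

Lemma rank1_pi_relation (n : nat) (n_gt0 : (0 < n)%N) p :
  rank1_relations n p -> rank1_pi n_gt0 p = 0.
Proof.
move=> pG; rewrite -[RHS](rmorph0 (rank1_pi n_gt0)).
apply/eqP; rewrite -Quotient.idealrBE subr0; apply/asboolP.
exists [:: (1, p)]; last by rewrite big_seq1 mul1r.
by move=> c; rewrite inE => /eqP ->.
Qed.

Lemma rank1_ring_lift (n : nat) (n_gt0 : (0 < n)%N) (R : comPzRingType)
    (f : {rmorphism {mpoly int[n * n]} -> R}) :
  (forall p, rank1_relations n p -> f p = 0) ->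
  exists g : {rmorphism rank1_ring n_gt0 -> R},
    forall p, g (rank1_pi n_gt0 p) = f p.
Proof.
move=> f0; apply: ideal_quot_lift => p /asboolP[s sG ->].
rewrite rmorph_sum big_seq big1 // => c /sG cG.
by rewrite rmorphM (f0 _ cG) mulr0.
Qed.

Lemma universal_rank1_projection (n : nat) (n_gt0 : (0 < n)%N) :
  rank1_projection (map_mx (rank1_pi n_gt0) (generic_mx n)).
Proof.
apply/rank1_equations_projection/rank1_equations_generic.
exact: rank1_pi_relation.
Qed.

Theorem theorem4p0p7 (n : nat) (n_gt0 : (0 < n)%N) :
  represented_by (rank1_functor n) (rank1_ring n_gt0).
Proof.
pose u : rank1_functor n (rank1_ring n_gt0) :=
  exist _ _ (universal_rank1_projection n_gt0).
exists (fun R f => fmap (rank1_functor n) f u); split; last first.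
  by move=> R S f g; exact: fmap_comp.
move=> R; rewrite -setTT_bijective; split=> // [f g _ _ /(congr1 sval) fg|].
  (* two morphisms that agree on the universal matrix agree on the classes of
     the variables, which generate the quotient *)
  apply: rmorph_ext => x; rewrite -[x]reprK; move: (repr x) => p.
  apply: (mpoly_int_hom_eq (f := f \o rank1_pi n_gt0)
                           (g := g \o rank1_pi n_gt0)) => k.
  case/mxvec_indexP: k => i j.
  by move/matrixP/(_ i j): fg; rewrite !mxE.
move=> [q q1] _.
(* evaluate the variables at the entries of [q], then factor *)
have [f fX] := mpoly_int_lift (mxvec q ord0).
have fx : map_mx f (generic_mx n) = q.
  by apply/matrixP => i j; rewrite !mxE fX mxvecE.
have /(rank1_ring_lift n_gt0)[g gpi] :
    forall p, rank1_relations n p -> f p = 0.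
  by apply/rank1_equations_generic; rewrite fx; apply: rank1_projection_equations.
exists g => //; apply: eq_sig_hprop => [?|]; first exact: Prop_irrelevance.
rewrite /= -fx; apply/matrixP => i j.
by rewrite [LHS]mxE [X in g X]mxE gpi [RHS]mxE.
Qed.
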